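(* Let $g$ be an invertible Hermitian $n\times n$ complex matrix which is indefinite (neither positive nor negative definite), and let $\alpha,\beta$ be complex $n\times n$ matrices such that 1. $\alpha$ and $\beta$ have rank $n$, 2. $-\alpha^T\beta+\beta^T\alpha=0$, 3. $\beta^T\bar\alpha-\alpha^T\bar\beta=8\mathrm i\,g$. Then there exists a real symplectic matrix $S\in\mathrm{Sp}(2n,\mathbb R)$ such that the blocks $\hat\alpha,\hat\beta$ of $$\begin{pmatrix}\hat\alpha\\ \hat\beta\end{pmatrix}=S\begin{pmatrix}\alpha\\ \beta\end{pmatrix}$$ satisfy $\operatorname{rank}\hat\alpha<n$ and $\operatorname{rank}\hat\beta<n$.
   Context: $\mathrm{Sp}(2n,\mathbb R)$ is the group of real $2n\times2n$ matrices $S$ with $S^TPS=P$, $P=\begin{pmatrix}0&\mathbb 1_n\\-\mathbb 1_n&0\end{pmatrix}$. Bars denote entrywise complex conjugation and $T$ the transpose. *)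

(* Defs.v *)
From mathcomp Require Import all_boot all_order all_algebra.
From mathcomp Require Import sesquilinear spectral.
From mathcomp Require Export reals.
From mathcomp Require Export complex.

Set Implicit Arguments.
Unset Strict Implicit.
Unset Printing Implicit Defensive.

Import Order.TTheory GRing.Theory Num.Theory.
Local Open Scope ring_scope.
Local Open Scope complex_scope.
Local Open Scope sesquilinear_scope.

(* On a [numClosedFieldType] the inequality [0 < z] means that z is real and
   positive, so this is definiteness of the sesquilinear form v^* g v on column
   vectors. *)
Definition posdefmx (C : numClosedFieldType) (n : nat) (g : 'M[C]_n) : Prop :=
  forall v : 'cV[C]_n, v != 0 -> 0 < (v ^t* *m g *m v) 0 0.

Definition negdefmx (C : numClosedFieldType) (n : nat) (g : 'M[C]_n) : Prop :=
  forall v : 'cV[C]_n, v != 0 -> (v ^t* *m g *m v) 0 0 < 0.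

Definition indefinitemx (C : numClosedFieldType) (n : nat) (g : 'M[C]_n) :
    Prop :=
  ~ posdefmx g /\ ~ negdefmx g.

Definition sympl_mx (R : comNzRingType) (n : nat) : 'M[R]_(n + n) :=
  block_mx 0 1%:M (- 1%:M) 0.

Definition symplectic (R : comNzRingType) (n : nat) :=
  [qualify S : 'M[R]_(n + n) | S^T *m sympl_mx R n *m S == sympl_mx R n].

Definition complexmx (R : rcfType) (m p : nat) (A : 'M[R]_(m, p)) :
    'M[R[i]]_(m, p) :=
  map_mx (real_complex R) A.

(* Main.v *)
Require Import Defs.
From mathcomp Require Import all_boot all_order all_algebra.
From mathcomp Require Import sesquilinear spectral.
From mathcomp Require Import ring lra boolp.

Set Implicit Arguments.
Unset Strict Implicit.
Unset Printing Implicit Defensive.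

Import Order.TTheory GRing.Theory Num.Theory.
Local Open Scope ring_scope.
Local Open Scope sesquilinear_scope.

(* Let L be the complex column span of (alpha; beta), omega the symplectic
   form and h(z, w) := omega(z, conj w), which is a multiple of g on L. The
   complexified kernel of the upper (or lower) half of a real symplectic S
   is a Lagrangian subspace, and it contains z = x + i y as soon as it
   contains x and y. Since g is indefinite and nondegenerate, L contains a
   hyperbolic pair z1, z2 for h: both are h-null and h(z1, z2) <> 0. As L is
   omega-isotropic, the planes <x1, y1> and <x2, y2> are then
   omega-isotropic and in duality. Products of transvections act transitively on
   such pairs of planes, so some real symplectic S carries the first one
   into {0} x R^n and the second one into R^n x {0}; this makes z1 a kernel
   vector of the new alpha and z2 one of the new beta. *)

(** * Bilinear forms and their isometries *)

Definition bform (F : comNzRingType) (m : nat) (J : 'M[F]_m)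
    (u v : 'cV[F]_m) : F :=
  (u^T *m J *m v) 0 0.

Section BilinearForm.
Variables (F : comNzRingType) (m : nat) (J : 'M[F]_m).
Local Notation "''[' u , v ]" := (bform J u v) : ring_scope.

Lemma bformDl u u' v : '[u + u', v] = '[u, v] + '[u', v].
Proof. by rewrite /bform linearD !mulmxDl mxE. Qed.

Lemma bformDr u v v' : '[u, v + v'] = '[u, v] + '[u, v'].
Proof. by rewrite /bform !mulmxDr mxE. Qed.

Lemma bformZl a u v : '[a *: u, v] = a * '[u, v].
Proof. by rewrite /bform linearZ -!scalemxAl mxE. Qed.

Lemma bformZr a u v : '[u, a *: v] = a * '[u, v].
Proof. by rewrite /bform -!scalemxAr mxE. Qed.

Lemma bformBl u u' v : '[u - u', v] = '[u, v] - '[u', v].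
Proof. by rewrite bformDl -scaleN1r bformZl mulN1r. Qed.

Lemma bformBr u v v' : '[u, v - v'] = '[u, v] - '[u, v'].
Proof. by rewrite bformDr -scaleN1r bformZr mulN1r. Qed.

Definition bformE := (bformBl, bformBr, bformDl, bformDr, bformZl, bformZr).

Definition isometry_mx (S : 'M[F]_m) := S^T *m J *m S = J.

Lemma isometry_mxP S :
  isometry_mx S <-> forall x y, '[S *m x, S *m y] = '[x, y].
Proof.
split=> [isoS x y|isoS].
  by rewrite /bform trmx_mul -[in RHS]isoS !mulmxA.
apply/matrixP=> i j.
have entry (A : 'M[F]_m) : A i j =
    ((delta_mx i 0 : 'cV_m)^T *m A *m (delta_mx j 0 : 'cV_m)) 0 0.
  by rewrite trmx_delta -rowE -colE !mxE.
by rewrite !entry -[RHS]isoS /bform trmx_mul !mulmxA.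
Qed.

Lemma isometry_mxM S T : isometry_mx S -> isometry_mx T -> isometry_mx (S *m T).
Proof.
move=> /isometry_mxP isoS /isometry_mxP isoT; apply/isometry_mxP => x y.
by rewrite -!mulmxA isoS isoT.
Qed.
End BilinearForm.

(** * Transvections and their transitivity on hyperbolic pairs *)

Section Alternating.
Variables (F : fieldType) (m : nat) (J : 'M[F]_m).
Local Notation "''[' u , v ]" := (bform J u v) : ring_scope.
Hypothesis bform_alt : forall u, '[u, u] = 0.

Lemma alt_bformC u v : '[u, v] = - '[v, u].
Proof.
apply/eqP; rewrite -addr_eq0; apply/eqP.
by have := bform_alt (u + v); rewrite !bformE !bform_alt add0r addr0.
Qed.

(* The isometry is the transvection along [y - x]. *)
Lemma transvection_to x y : '[x, y] != 0 ->
  exists2 S, isometry_mx J S &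
    S *m x = y /\ forall c, '[c, x] = '[c, y] -> S *m c = c.
Proof.
move=> nz_xy; pose u := y - x.
pose S := 1%:M - '[x, y]^-1 *: (u *m (u^T *m J)).
have SE c : S *m c = c - ('[x, y]^-1 * '[u, c]) *: u.
  rewrite mulmxBl mul1mx -scalemxAl -mulmxA [u^T *m J *m c]mx11_scalar.
  by rewrite mul_mx_scalar scalerA.
have ux : '[u, x] = - '[x, y] by rewrite !bformE bform_alt subr0 alt_bformC.
exists S; last split.
- apply/isometry_mxP=> a b; rewrite !SE {S SE ux}.
  move: '[x, y]^-1 (u) => k w; rewrite !bformE bform_alt (alt_bformC a w).
  by ring.
- by rewrite SE ux mulrN mulVf // scaleN1r opprK addrC subrK.
- move=> c cxy; rewrite SE (alt_bformC u) (bformBr J c) cxy subrr oppr0.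
  by rewrite mulr0 scale0r subr0.
Qed.

(** When [x] and [y] are orthogonal no single transvection need suffice, so the move goes through a
    vector [w] pairing nontrivially with both: one of [z], [z'], [z + z'] always works. Vectors
    orthogonal to [x], [w] and [y] are fixed by both transvections. *)
Lemma isometry_to x y z z' : '[x, z] != 0 -> '[y, z'] != 0 ->
  exists2 S, isometry_mx J S & S *m x = y /\
    forall c, '[c, x] = 0 -> '[c, y] = 0 -> '[c, z] = 0 -> '[c, z'] = 0 ->
      S *m c = c.
Proof.
move=> xz yz'.
have [w [xw yw cw]] : exists w, [/\ '[x, w] != 0, '[y, w] != 0 &
    forall c, '[c, z] = 0 -> '[c, z'] = 0 -> '[c, w] = 0].
  have [yz|yz] := eqVneq '[y, z] 0; last by exists z.
  have [xz'|xz'] := eqVneq '[x, z'] 0; last by exists z'.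
  exists (z + z'); split; rewrite ?bformDr ?yz ?xz' ?add0r ?addr0 //.
  by move=> c cz cz'; rewrite bformDr cz cz' addr0.
have wy : '[w, y] != 0 by rewrite alt_bformC oppr_eq0.
have [S isoS [Sx Sc]] := transvection_to xw.
have [T isoT [Tw Tc]] := transvection_to wy.
exists (T *m S); first exact: isometry_mxM.
split=> [|c cx cy cz cz']; rewrite -mulmxA; first by rewrite Sx.
by have cw0 := cw c cz cz'; rewrite Sc ?cx ?cw0 // Tc ?cw0 ?cy.
Qed.

(** A transvection along [e' - e] fixes [f], because [f] pairs equally with [e] and [e']. If [e] and
    [e'] are orthogonal, the detour through [f + e] works: [f] pairs to 1 with it as well, and it is
    orthogonal to neither [e] nor [e']. *)
Lemma isometry_hyperbolic_partner f e e' : '[f, e] = 1 -> '[f, e'] = 1 ->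
  exists2 S, isometry_mx J S & [/\ S *m f = f, S *m e = e' &
    forall c, '[c, f] = 0 -> '[c, e] = 0 -> '[c, e'] = 0 -> S *m c = c].
Proof.
move=> fe fe'; have [ee'|ee'] := eqVneq '[e, e'] 0; last first.
  have [S isoS [Se Sc]] := transvection_to ee'; exists S => //; split=> //.
    by rewrite Sc // fe.
  by move=> c _ ce ce'; rewrite Sc // ce.
have ez : '[e, f + e] != 0.
  by rewrite bformDr bform_alt addr0 alt_bformC fe oppr_eq0 oner_eq0.
have ze' : '[f + e, e'] != 0 by rewrite bformDl ee' fe' addr0 oner_eq0.
have [S isoS [Se Sc]] := transvection_to ez.
have [T isoT [Te Tc]] := transvection_to ze'.
exists (T *m S); first exact: isometry_mxM.
split=> [||c cf ce ce']; rewrite -mulmxA.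
- by rewrite Sc ?Tc // bformDr bform_alt add0r // fe.
- by rewrite Se.
- by rewrite Sc ?Tc // bformDr cf ce addr0.
Qed.

(** First [f] is moved to [f'], then the image of [e] is corrected to [e'] with [f'] held fixed. The
    clause on [c] allows a second pair to be moved later without disturbing the first. *)
Lemma isometry_hyperbolic_pair f e f' e' : '[f, e] = 1 -> '[f', e'] = 1 ->
  exists2 S, isometry_mx J S & [/\ S *m f = f', S *m e = e' &
    forall c, '[c, f] = 0 -> '[c, e] = 0 -> '[c, f'] = 0 -> '[c, e'] = 0 ->
      S *m c = c].
Proof.
move=> fe fe'.
have [||S isoS [Sf Sc]] := @isometry_to f f' e e';
  rewrite ?fe ?fe' ?oner_eq0 //.
have f'Se : '[f', S *m e] = 1 by rewrite -Sf (isometry_mxP J S).1.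
have [T isoT [Tf Te Tc]] := isometry_hyperbolic_partner f'Se fe'.
exists (T *m S); first exact: isometry_mxM.
split=> [||c cf ce cf' ce']; rewrite -mulmxA ?Sf //.
have Scc : S *m c = c by apply: Sc.
by rewrite Scc Tc // -Scc (isometry_mxP J S).1.
Qed.

Definition hyperbolic_quadruple f0 e0 f1 e1 :=
  ('[f0, e0] = 1 /\ '[f1, e1] = 1) /\
  [/\ '[f0, f1] = 0, '[f0, e1] = 0, '[e0, f1] = 0 & '[e0, e1] = 0].

Lemma isometry_hyperbolic_quadruple f0 e0 f1 e1 f0' e0' f1' e1' :
    hyperbolic_quadruple f0 e0 f1 e1 -> hyperbolic_quadruple f0' e0' f1' e1' ->
  exists2 S, isometry_mx J S &
    [/\ S *m f0 = f0', S *m e0 = e0', S *m f1 = f1' & S *m e1 = e1'].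
Proof.
move=> [[fe0 fe1] [f0f1 f0e1 e0f1 e0e1]].
move=> [[fe0' fe1'] [f0f1' f0e1' e0f1' e0e1']].
have [S isoS [Sf0 Se0 _]] := isometry_hyperbolic_pair fe0 fe0'.
have SE := (isometry_mxP J S).1 isoS.
have fe1S : '[S *m f1, S *m e1] = 1 by rewrite SE.
have [T isoT [Tf1 Te1 Tc]] := isometry_hyperbolic_pair fe1S fe1'.
exists (T *m S); first exact: isometry_mxM.
(* [T] fixes [f0'] and [e0']: they are orthogonal to [f1'] and [e1'] by hypothesis, and to [S *m f1]
   and [S *m e1] because they are the [S]-images of [f0] and [e0]. *)
by split; rewrite -mulmxA // ?Sf0 ?Se0 Tc // -?Sf0 -?Se0 SE.
Qed.
End Alternating.

(** * The standard symplectic form *)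

Section Symplectic.
Variables (F : fieldType) (n : nat).
Local Notation J := (sympl_mx F n).

Lemma bform_sympl_mx (a b c d : 'cV[F]_n) :
  bform J (col_mx a b) (col_mx c d) = (a^T *m d) 0 0 - (b^T *m c) 0 0.
Proof.
rewrite /bform /sympl_mx tr_col_mx mul_row_block mul_row_col.
by rewrite !mulmx0 !add0r addr0 mulmx1 mulmxN mulmx1 mulNmx addrC !mxE.
Qed.

(** Through this formula the matrix equations on [alpha] and [beta] become values of the symplectic
    form on the column span of the stacked matrix. *)
Lemma bform_sympl_mx_col (p q : nat) (A B : 'M[F]_(n, p)) (A' B' : 'M[F]_(n, q))
    (u : 'cV[F]_p) (v : 'cV[F]_q) :
  bform J (col_mx A B *m u) (col_mx A' B' *m v) =
    (u^T *m (A^T *m B' - B^T *m A') *m v) 0 0.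
Proof.
rewrite !mul_col_mx bform_sympl_mx !trmx_mul mulmxBr mulmxBl !mulmxA.
by rewrite [in RHS]mxE [X in _ = _ + X]mxE.
Qed.

Lemma sympl_mx_alt (u : 'cV[F]_(n + n)) : bform J u u = 0.
Proof.
rewrite -[u]vsubmxK bform_sympl_mx; apply/eqP; rewrite subr_eq0; apply/eqP.
have -> : (dsubmx u)^T *m usubmx u = ((usubmx u)^T *m dsubmx u)^T.
  by rewrite trmx_mul trmxK.
by rewrite [RHS]mxE.
Qed.

(** The quadruple is carried to a standard one built from two coordinate directions, whence [1 < n].
    The sign in [e] makes each [f i] pair to +1 with [e i]. *)
Lemma symplectic_adapted (f0 e0 f1 e1 : 'cV[F]_(n + n)) :
    (1 < n)%N -> hyperbolic_quadruple J f0 e0 f1 e1 ->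
  exists2 S, S \is symplectic F n &
    [/\ usubmx (S *m f0) = 0, usubmx (S *m f1) = 0,
        dsubmx (S *m e0) = 0 & dsubmx (S *m e1) = 0].
Proof.
move=> n_gt1 quad; pose i0 := Ordinal (ltnW n_gt1); pose i1 := Ordinal n_gt1.
pose f i : 'cV[F]_(n + n) := col_mx 0 (delta_mx i 0).
pose e i : 'cV[F]_(n + n) := col_mx (- delta_mx i 0) 0.
have quad' : hyperbolic_quadruple J (f i0) (e i0) (f i1) (e i1).
  have dE i j : ((delta_mx i 0 : 'cV[F]_n)^T *m delta_mx j 0) 0 0 = (i == j)%:R.
    by rewrite trmx_delta mul_delta_mx_cond; case: (i == j); rewrite !mxE.
  have ff i j : bform J (f i) (f j) = 0.
    by rewrite bform_sympl_mx trmx0 mul0mx mulmx0 subrr.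
  have ee i j : bform J (e i) (e j) = 0.
    by rewrite bform_sympl_mx trmx0 mul0mx mulmx0 subrr.
  have fe i j : bform J (f i) (e j) = (i == j)%:R.
    rewrite bform_sympl_mx trmx0 mul0mx mulmxN [X in X - _]mxE.
    by rewrite [X in _ - X]mxE opprK add0r dE.
  by split; split; rewrite ?fe // (alt_bformC sympl_mx_alt) fe oppr0.
have [S isoS [Sf0 Se0 Sf1 Se1]] :=
  isometry_hyperbolic_quadruple sympl_mx_alt quad quad'.
exists S; first by rewrite qualifE; apply/eqP.
by rewrite Sf0 Se0 Sf1 Se1 !col_mxKu !col_mxKd.
Qed.
End Symplectic.

(** * Null vectors of an indefinite Hermitian form *)

Definition hform (C : numClosedFieldType) (n : nat) (g : 'M[C]_n)
    (v w : 'cV[C]_n) : C :=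
  (v ^t* *m g *m w) 0 0.

Section HermitianForm.
Variables (C : numClosedFieldType) (n : nat) (g : 'M[C]_n).
Local Notation "''[' v , w ]" := (hform g v w) : ring_scope.

Lemma hformDl v v' w : '[v + v', w] = '[v, w] + '[v', w].
Proof. by rewrite /hform linearD /= map_mxD !mulmxDl mxE. Qed.

Lemma hformDr v w w' : '[v, w + w'] = '[v, w] + '[v, w'].
Proof. by rewrite /hform !mulmxDr mxE. Qed.

Lemma hformZl a v w : '[a *: v, w] = a^* * '[v, w].
Proof. by rewrite /hform linearZ /= map_mxZ -!scalemxAl mxE. Qed.

Lemma hformZr a v w : '[v, a *: w] = a * '[v, w].
Proof. by rewrite /hform -!scalemxAr mxE. Qed.

Definition hformE := (hformDl, hformDr, hformZl, hformZr).

Hypothesis g_herm : g \is hermsymmx.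

Lemma hformC v w : '[w, v] = ('[v, w])^*.
Proof.
have gE : g ^t* = g.
  by have := g_herm; rewrite is_hermitianmxE expr0 scale1r eq_sym => /eqP.
have -> : ('[v, w])^* = ((v ^t* *m g *m w) ^t*) 0 0 by rewrite /hform !mxE.
by rewrite !trmx_mul !map_mxM gE trmxCK mulmxA.
Qed.

Lemma hform_real v : '[v, v] \is Num.real.
Proof. by rewrite CrealE -hformC eqxx. Qed.

(* Rescaling [w] by ['i * '[w, v]] makes ['[v, w]] purely imaginary: the
   cross term vanishes and a null combination is found by extracting a
   single square root. *)
Lemma hform_null v w : '[v, v] < 0 -> 0 < '[w, w] ->
  exists2 u, u != 0 & '[u, u] = 0.
Proof.
move=> v_neg w_pos.
have [s [s_neq0 cross]] : exists s : C,
    s != 0 /\ s * '[v, w] + s^* * '[w, v] = 0.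
  have [vw0|vw0] := eqVneq '[v, w] 0.
    by exists 1; rewrite oner_eq0 vw0 hformC vw0 conjC0 !mulr0 addr0.
  exists ('i * '[w, v]); split.
    by rewrite mulf_neq0 ?neq0Ci // hformC conjC_eq0.
  by rewrite rmorphM /= conjCi -hformC; ring.
pose q := s * s^* * '[w, w].
have q_pos : 0 < q by rewrite mulr_gt0 // mul_conjC_gt0.
pose t := sqrtC (- '[v, v] / q).
have t_ge0 : 0 <= t by rewrite sqrtC_ge0 divr_ge0 ?oppr_ge0 ?ltW.
have t_real : t^* = t by apply/CrealP/ger0_real.
have tt : t ^+ 2 * q = - '[v, v] by rewrite sqrtCK divfK // gt_eqF.
exists (v + (t * s) *: w); last first.
  rewrite !hformE rmorphM /= t_real.
  have -> : '[v, v] + t * s * '[v, w] +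
      (t * s^* * '[w, v] + t * s^* * (t * s * '[w, w])) =
    '[v, v] + t ^+ 2 * q + t * (s * '[v, w] + s^* * '[w, v]).
    by rewrite /q; ring.
  by rewrite cross tt mulr0 addr0 subrr.
(* If the combination vanished, [v] would be a multiple of [w], and its form value could not be
   negative. *)
apply/eqP=> /eqP; rewrite addr_eq0 => /eqP vE; move: v_neg; rewrite vE.
rewrite -scaleNr hformZl hformZr mulrA [_^* * _]mulrC le_gtF //.
by rewrite mulr_ge0 ?mul_conjC_ge0 // ltW.
Qed.

Hypothesis g_unit : g \in unitmx.
Hypothesis g_indef : indefinitemx g.

Lemma indefinite_null_vector : exists2 u, u != 0 & '[u, u] = 0.
Proof.
have [not_pos not_neg] := g_indef.
have [v v_neq0 v_le0] : exists2 v, v != 0 & '[v, v] <= 0.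
  apply: contrapT => no_v; apply: not_pos => v v_neq0.
  rewrite real_ltNge ?real0 ?hform_real //; apply/negP => v_le0.
  by apply: no_v; exists v.
have [w w_neq0 w_ge0] : exists2 w, w != 0 & 0 <= '[w, w].
  apply: contrapT => no_w; apply: not_neg => w w_neq0.
  rewrite real_ltNge ?real0 ?hform_real //; apply/negP => w_ge0.
  by apply: no_w; exists w.
have [vv|vv] := eqVneq '[v, v] 0; first by exists v.
have [ww|ww] := eqVneq '[w, w] 0; first by exists w.
by apply: (@hform_null v w); rewrite lt_def ?vv ?ww // eq_sym vv.
Qed.

(** As [g] is invertible, [u] is not orthogonal to everything, so some [w] pairs to 1 with it.
    Subtracting ['[w, w] / 2] times the null vector [u] makes [w] null and keeps that pairing. *)
Lemma null_partner u : u != 0 -> '[u, u] = 0 ->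
  exists2 w, '[w, w] = 0 & '[u, w] = 1.
Proof.
move=> u_neq0 uu.
have [k uk] : exists k, '[u, k] != 0.
  apply: contrapT => no_k; move/eqP: u_neq0; apply.
  have gu0 : u ^t* *m g = 0.
    apply/rowP=> j; rewrite [RHS]mxE; apply: contrapT => /eqP nz; apply: no_k.
    by exists (delta_mx j 0); rewrite /hform -colE [X in X != _]mxE.
  have := congr1 (fun A => (A *m invmx g) ^t*) gu0.
  by rewrite mulmxK // trmxCK mul0mx trmx0 map_mx0.
have [w uw] : exists w, '[u, w] = 1.
  by exists ('[u, k]^-1 *: k); rewrite hformZr mulVf.
have wu : '[w, u] = 1 by rewrite hformC uw conjC1.
exists (w - ('[w, w] / 2) *: u); last first.
  by rewrite -scaleNr hformDr hformZr uu mulr0 addr0.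
rewrite -scaleNr; set a := - _; have aa : a^* = a.
  by rewrite /a rmorphN rmorphM fmorphV /= -hformC conjC_nat.
by rewrite !hformE uu wu uw aa /a; field.
Qed.
End HermitianForm.

(** In dimension 1 a null [u] satisfies [u = 0] or is annihilated by [g], so it cannot pair to 1
    with anything. *)
Lemma null_pair_dim_gt1 (C : numClosedFieldType) n (g : 'M[C]_n) u w :
  hform g u u = 0 -> hform g u w = 1 -> (1 < n)%N.
Proof.
case: n => [|[|n]] // in g u w *.
  move=> _; rewrite [w]flatmx0 /hform mulmx0 mxE => /esym/eqP.
  by rewrite oner_eq0.
have hE x y : hform g x y = (x 0 0)^* * g 0 0 * y 0 0.
  by rewrite /hform !(mxE, big_ord1).
rewrite !hE => /eqP; rewrite mulf_eq0 => /orP[/eqP->|/eqP->].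
  by rewrite mul0r => /esym/eqP; rewrite oner_eq0.
by rewrite conjC0 !mul0r => /esym/eqP; rewrite oner_eq0.
Qed.

Lemma singular_rank_lt (F : fieldType) n (A : 'M[F]_n) (v : 'cV[F]_n) :
  v != 0 -> A *m v = 0 -> (\rank A < n)%N.
Proof.
move=> v_neq0 Av; rewrite ltn_neqAle rank_leq_row andbT.
apply: contraNneq v_neq0 => rankA; have A_unit : A \in unitmx.
  by rewrite -row_free_unit /row_free rankA.
by rewrite -[v](mulKmx A_unit) Av mulmx0.
Qed.

Local Open Scope complex_scope.

(** * Real and imaginary parts of complex vectors *)

Section Complexification.
Variable R : rcfType.
Local Notation Rex A := (map_mx (@complex.Re R) A).
Local Notation Imx A := (map_mx (@complex.Im R) A).

Lemma complexmxM m p q (A : 'M[R]_(m, p)) (B : 'M_(p, q)) :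
  complexmx (A *m B) = complexmx A *m complexmx B.
Proof. exact: map_mxM. Qed.

Lemma mx_complexE m p (A : 'M[R[i]]_(m, p)) :
  A = complexmx (Rex A) + 'i%C *: complexmx (Imx A).
Proof. by apply/matrixP=> i j; rewrite !mxE -complexE. Qed.

Lemma conj_mx_complexE m p (A : 'M[R[i]]_(m, p)) :
  map_mx conjc A = complexmx (Rex A) + (- 'i%C) *: complexmx (Imx A).
Proof.
apply/matrixP=> i j; rewrite !mxE; case: (A i j) => a b /=.
by apply/eqP; rewrite eq_complex /=; apply/andP; split; apply/eqP; ring.
Qed.

Lemma complexmx_sympl n : complexmx (sympl_mx R n) = sympl_mx R[i] n.
Proof.
by rewrite /complexmx /sympl_mx map_block_mx !map_mxN !map_mx0 !map_mx1.
Qed.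

Lemma bform_complexmx m (J : 'M[R]_m) u v :
  bform (complexmx J) (complexmx u) (complexmx v) = (bform J u v)%:C.
Proof. by rewrite /bform /complexmx map_trmx -!map_mxM mxE. Qed.

Lemma bform_complexE m (J : 'M[R]_m) z w :
  bform (complexmx J) z w =
    (bform J (Rex z) (Rex w) - bform J (Imx z) (Imx w)) +i*
    (bform J (Rex z) (Imx w) + bform J (Imx z) (Rex w)).
Proof.
rewrite {1}[z]mx_complexE {1}[w]mx_complexE !bformE !bform_complexmx.
by apply/eqP; rewrite eq_complex /=; apply/andP; split; apply/eqP; ring.
Qed.

Lemma bform_complex_conjE m (J : 'M[R]_m) z w :
  bform (complexmx J) z (map_mx conjc w) =
    (bform J (Rex z) (Rex w) + bform J (Imx z) (Imx w)) +i*
    (bform J (Imx z) (Rex w) - bform J (Rex z) (Imx w)).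
Proof.
rewrite {1}[z]mx_complexE conj_mx_complexE !bformE !bform_complexmx.
by apply/eqP; rewrite eq_complex /=; apply/andP; split; apply/eqP; ring.
Qed.

Lemma usubmx_complexmx_mul m p q (S : 'M[R]_(m + p, q)) (z : 'cV[R[i]]_q) :
  usubmx (S *m Rex z) = 0 -> usubmx (S *m Imx z) = 0 ->
  usubmx (complexmx S *m z) = 0.
Proof.
move=> Sx Sy; rewrite [z]mx_complexE mulmxDr -scalemxAr -!complexmxM.
by rewrite linearD linearZ /= -!map_usubmx Sx Sy !map_mx0 scaler0 addr0.
Qed.

Lemma dsubmx_complexmx_mul m p q (S : 'M[R]_(m + p, q)) (z : 'cV[R[i]]_q) :
  dsubmx (S *m Rex z) = 0 -> dsubmx (S *m Imx z) = 0 ->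
  dsubmx (complexmx S *m z) = 0.
Proof.
move=> Sx Sy; rewrite [z]mx_complexE mulmxDr -scalemxAr -!complexmxM.
by rewrite linearD linearZ /= -!map_dsubmx Sx Sy !map_mx0 scaler0 addr0.
Qed.

Lemma oppB_self_eq0 (a : R) : - a - a = 0 -> a = 0.
Proof. by move=> h; lra. Qed.

(** Nullity of [z] and of [w] says that the real part of each is orthogonal to its imaginary part.
    Comparing the values at [w] and at its conjugate gives a linear system: Re-Re and Im-Im pairings
    vanish, Re [z] with Im [w] gives 4, Im [z] with Re [w] gives -4. Hence the factors [4^-1] and
    [- 4^-1]. *)
Lemma hyperbolic_quadruple_complex m (J : 'M[R]_m) (z w : 'cV[R[i]]_m) :
    (forall u, bform J u u = 0) ->
    bform (complexmx J) z (map_mx conjc z) = 0 ->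
    bform (complexmx J) w (map_mx conjc w) = 0 ->
    bform (complexmx J) z w = 0 ->
    bform (complexmx J) z (map_mx conjc w) = - (8 * 'i%C) ->
  hyperbolic_quadruple J
    (Rex z) (4^-1 *: Imx w) (Imx z) ((- 4^-1) *: Rex w).
Proof.
move=> J_alt; have JC := alt_bformC J_alt.
rewrite !bform_complex_conjE bform_complexE.
rewrite (JC (Imx z) (Rex z)) (JC (Imx w) (Rex w)).
move=> [_ /oppB_self_eq0 zz] [_ /oppB_self_eq0 ww] [re_zw im_zw] zw.
have e8 : - (8 * 'i%C) = 0 +i* (- 8) :> R[i].
  by rewrite -[8]/(8%:R) -(rmorph_nat (real_complex R)) /=; simpc.
move: zw; rewrite e8 => -[re_zw' im_zw'].
rewrite /hyperbolic_quadruple !bformZr !bformZl.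
rewrite (JC (Imx w) (Imx z)) (JC (Imx w) (Rex w)) zz ww.
clear JC J_alt zz ww.
move: re_zw im_zw re_zw' im_zw'.
move: (bform _ _ _) (bform _ _ _) (bform _ _ _) (bform _ _ _).
move=> {z w J} a b c d *.
by split; split; lra.
Qed.
End Complexification.

(** * Construction of the symplectic matrix *)

Theorem mainTheorem6 (R : realType) (n : nat) (g alpha beta : 'M[R[i]]_n)
    (g_unit : g \in unitmx)
    (g_herm : g \is hermsymmx)
    (g_indef : indefinitemx g)
    (rank_alpha : \rank alpha = n)
    (rank_beta : \rank beta = n)
    (isotropic : - (alpha^T *m beta) + beta^T *m alpha = 0)
    (hermitian_eq : beta^T *m map_mx conjc alpha - alpha^T *m map_mx conjc beta
                    = (8 * 'i%C) *: g) :
  exists2 S : 'M[R]_(n + n), S \is symplectic R n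
    & let hat := complexmx S *m col_mx alpha beta in
      (\rank (usubmx hat) < n)%N /\ (\rank (dsubmx hat) < n)%N.
Proof.
have [u1 u1_neq0 u11] := indefinite_null_vector g_herm g_indef.
have [u2 u22 u12] := null_partner g_herm g_unit u1_neq0 u11.
have n_gt1 := null_pair_dim_gt1 u11 u12.
(* The coefficient vectors are conjugated because [hform] is conjugate-linear in its first argument,
   while the symplectic form is bilinear. *)
pose Z := col_mx alpha beta; pose c (u : 'cV[R[i]]_n) := map_mx conjc u.
have isoZ u v : bform (complexmx (sympl_mx R n)) (Z *m c u) (Z *m c v) = 0.
  have ab : alpha^T *m beta - beta^T *m alpha = 0.
    by rewrite -[LHS]opprB -[RHS]oppr0 -isotropic addrC.
  by rewrite complexmx_sympl bform_sympl_mx_col ab mulmx0 mul0mx mxE.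
have hermZ u v : bform (complexmx (sympl_mx R n)) (Z *m c u)
    (map_mx conjc (Z *m c v)) = - (8 * 'i%C) * hform g u v.
  have ccv : map_mx conjc (c v) = v.
    by apply/matrixP=> i j; rewrite !mxE conjcK.
  have ab : alpha^T *m map_mx conjc beta - beta^T *m map_mx conjc alpha =
      (- (8 * 'i%C)) *: g by rewrite scaleNr -hermitian_eq opprB.
  rewrite complexmx_sympl map_mxM map_col_mx ccv bform_sympl_mx_col ab.
  by rewrite -scalemxAr -scalemxAl [LHS]mxE map_trmx.
have z11 := hermZ u1 u1; rewrite u11 mulr0 in z11.
have z22 := hermZ u2 u2; rewrite u22 mulr0 in z22.
have z12 := hermZ u1 u2; rewrite u12 mulr1 in z12.
have quad := hyperbolic_quadruple_complex (@sympl_mx_alt _ n)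
  z11 z22 (isoZ u1 u2) z12.
have [S symplS [Sx1 Sy1 Sy2 Sx2]] := symplectic_adapted n_gt1 quad.
exists S => //=.
(* This strips the factors [4^-1] and [- 4^-1] from the second vectors of the hyperbolic pairs,
   leaving the parts of [Z *m c u2]. *)
have unscale (a : R) (v : 'cV_(n + n)) :
    a != 0 -> dsubmx (S *m (a *: v)) = 0 -> dsubmx (S *m v) = 0.
  move=> a_neq0; rewrite -scalemxAr linearZ /= => /eqP.
  by rewrite scaler_eq0 (negPf a_neq0) => /eqP.
have u2_neq0 : u2 != 0.
  by apply: contra_eq_neq u12 => ->; rewrite /hform mulmx0 mxE eq_sym oner_eq0.
(* The kernel vectors of the new upper and lower blocks are [c u1] and [c u2]. *)
split; [apply: (@singular_rank_lt _ _ _ (c u1))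
       |apply: (@singular_rank_lt _ _ _ (c u2))]; rewrite ?map_mx_eq0 //.
  by rewrite mul_usub_mx -mulmxA; apply: usubmx_complexmx_mul.
rewrite mul_dsub_mx -mulmxA; apply: dsubmx_complexmx_mul.
  by apply: unscale Sx2; rewrite oppr_eq0 invr_eq0 pnatr_eq0.
by apply: unscale Sy2; rewrite invr_eq0 pnatr_eq0.
Qed.
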